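(* Let $q=2^m>2$, and let $\mathcal{U}_1=\mathcal{U}_{1,b}$ and $\mathcal{U}_2=\mathcal{U}_{1,b'}$ be any two non-classical orthogonal Buekenhout–Metz unitals of $\mathrm{PG}(2,q^2)$. Then $\mathcal{U}_1$ and $\mathcal{U}_2$ contain the same number of BM-special Fano planes.
   Context: Let $q=2^m$. The absolute trace of $x\in\mathbb{F}_q$ is $x+x^2+x^{4}+\cdots+x^{2^{m-1}}$. For $a,b\in\mathbb{F}_{q^2}$ with $b^q\neq b$ and $d=a^{q+1}/(b^q+b)^2$ of absolute trace $0$, the orthogonal Buekenhout–Metz (BM) unital is $\mathcal{U}_{a,b}=\{(x,ax^2+bx^{q+1}+r,1)\colon r\in\mathbb{F}_q,\ x\in\mathbb{F}_{q^2}\}\cup\{T_\infty=(0,1,0)\}$ in $\mathrm{PG}(2,q^2)$; it is a unital (a $2$-$(q^3+1,q+1,1)$ design whose blocks are its intersections of size $q+1$ with lines of $\mathrm{PG}(2,q^2)$), it is classical iff $a=0$, and $T_\infty$ is its special point. A Fano plane contained in the unital is a set of seven points of the unital and seven lines of $\mathrm{PG}(2,q^2)$, each line containing exactly three of the points, with the incidence structure of $\mathrm{PG}(2,2)$. Such a Fano plane is BM-special if one of its seven lines, as a line of $\mathrm{PG}(2,q^2)$, contains $T_\infty$. *)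

(* Defs.v *)
From HB Require Import structures.
From mathcomp Require Import all_boot all_order all_algebra.

Set Implicit Arguments.
Unset Strict Implicit.
Unset Printing Implicit Defensive.

Import GRing.Theory.
Local Open Scope ring_scope.

(* A subspace of F^3 is represented by the set of its vectors, so that points
   and lines of PG(2, F) range over the finite type {set 'rV[F]_3} and a point
   lies on a line iff it is a subset of it. *)
Definition pg_subspaces (F : finFieldType) (k : nat) : {set {set 'rV[F]_3}} :=
  [set A | [exists X : k.-tuple 'rV[F]_3,
              free X && (A == [set w | w \in <<X>>%VS])]].

Definition pg_points (F : finFieldType) := pg_subspaces F 1.

Definition pg_lines (F : finFieldType) := pg_subspaces F 2.

Definition incident (F : finFieldType) (p l : {set 'rV[F]_3}) : bool :=
  p \subset l.

Definition homog (F : finFieldType) (x y z : F) : {set 'rV[F]_3} :=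
  [set w | w \in <[\row_(i < 3) [:: x; y; z]`_i]>%VS].

Definition T_infty (F : finFieldType) : {set 'rV[F]_3} := homog 0 1 0.

Definition abs_trace (F : finFieldType) (m : nat) (x : F) : F :=
  \sum_(i < m) x ^+ (2 ^ i).

(* Standing assumptions on the parameters (a, b) of a BM unital.
   Here F has order q ^ 2; its subfield of order q is {r | r ^+ q = r}. *)
Definition BM_params (F : finFieldType) (m : nat) (a b : F) : Prop :=
  let q := (2 ^ m)%N in
  b ^+ q <> b /\ abs_trace m (a ^+ q.+1 / (b ^+ q + b) ^+ 2) = 0.

Definition BM_unital (F : finFieldType) (q : nat) (a b : F) :
    {set {set 'rV[F]_3}} :=
  [set homog x (a * x ^+ 2 + b * x ^+ q.+1 + r) 1
     | x in [set: F], r in [set r : F | r ^+ q == r]]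
  :|: [set T_infty F].

Definition iso_PG22 (F : finFieldType) (P L : {set {set 'rV[F]_3}}) : bool :=
  [exists f : {ffun {set 'rV['F_2]_3} -> {set 'rV[F]_3}},
   exists g : {ffun {set 'rV['F_2]_3} -> {set 'rV[F]_3}},
     [&& dinjectiveb f (mem (pg_points 'F_2)), f @: pg_points 'F_2 == P,
         dinjectiveb g (mem (pg_lines 'F_2)), g @: pg_lines 'F_2 == L &
         [forall p in pg_points 'F_2, forall l in pg_lines 'F_2,
            incident (f p) (g l) == incident p l]]].

(* A Fano plane is the pair (P, L) of its points and its lines, the latter being
   full lines of PG(2, F). *)
Definition fano_in (F : finFieldType) (U : {set {set 'rV[F]_3}})
    (P L : {set {set 'rV[F]_3}}) : bool :=
  [&& P \subset U, #|P| == 7%N, L \subset pg_lines F, #|L| == 7%N,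
      [forall l in L, #|[set p in P | incident p l]| == 3%N] & iso_PG22 P L].

Definition BM_special (F : finFieldType) (L : {set {set 'rV[F]_3}}) : bool :=
  [exists l in L, incident (T_infty F) l].

Definition BM_special_fanos (F : finFieldType) (U : {set {set 'rV[F]_3}}) :
    {set {set {set 'rV[F]_3}} * {set {set 'rV[F]_3}}} :=
  [set PL | fano_in U PL.1 PL.2 && BM_special PL.2].

(* Main.v *)
(* Write [c x = x ^+ q] and [B = b ^+ q + b].  The affine part of [U_(1,b)] is
   [y + c y = Q_B x] with [Q_B x = (x + c x) ^+ 2 + B * (x * c x)], and the trace
   condition makes the quadratic form [Q_B] anisotropic.  Since [Q_B] and [Q_B']
   differ by [(B + B') * (x * c x)], a shear [(x, y) |-> (x, y + d * x + e)] maps a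
   point of the first unital into the second iff [d * x + e] has a prescribed
   trace over the subfield of order [q].

   Let the special line be [x = 0] after a translation.  Anisotropy forces
   [T_infty] out of the Fano plane, and forces two of its points off this line to
   have abscissas [u1], [u2] independent over the subfield, so that exactly one
   [d] solves the conditions [Tr (d u) = (B + B') * (u * c u)] at these two
   points.  In terms of [1 / u] the condition is affine, and collinearity with
   points [(0, r)], [c r = r], makes every other [1 / u] an affine combination,
   over the subfield, of [1 / u1] and [1 / u2]; hence the same [d] works for the
   whole Fano plane.  Shears being involutions, these unique shears match the
   special Fano planes of the two unitals. *)

Require Import Defs.
From HB Require Import structures.
From mathcomp Require Import all_boot all_order all_algebra.
From mathcomp Require Import finfield ring.

Set Implicit Arguments.
Unset Strict Implicit.
Unset Printing Implicit Defensive.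

Import GRing.Theory.
Local Open Scope ring_scope.

(** * Algebra of the unital equation over a field of characteristic two with an involution [c] *)

Section CharacteristicTwo.

Variables (F : fieldType).
Hypothesis two0 : 2%:R = 0 :> F.

Lemma four0 : 4%:R = 0 :> F.
Proof. by rewrite (natrM _ 2 2) two0 mul0r. Qed.

Lemma six0 : 6%:R = 0 :> F.
Proof. by rewrite (natrM _ 2 3) two0 mul0r. Qed.

Lemma addr2_eq0 (x y : F) : (x + y == 0) = (x == y).
Proof.
suff -> : x + y = x - y by rewrite subr_eq0.
by apply: subr0_eq; rewrite -[RHS](mul0r y) -two0; ring.
Qed.

Lemma eq_add2 (x y : F) : x + y = 0 -> x = y.
Proof. by move/eqP; rewrite addr2_eq0 => /eqP. Qed.

Lemma add2_eq (x y : F) : x = y -> x + y = 0.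
Proof. by move/eqP; rewrite -addr2_eq0 => /eqP. Qed.

(** Linear combination in characteristic two: applied backwards, each hypothesis [a = b] is added to
    the goal with multiplier [k], until a polynomial identity for [ring] remains. *)
Lemma lin2 (k a b x y : F) : a = b -> x + y + k * (a + b) = 0 -> x = y.
Proof. by move=> /add2_eq ->; rewrite mulr0 addr0; apply: eq_add2. Qed.

Variable c : {rmorphism F -> F}.
Hypothesis cK : involutive c.

Definition unital_form (B x : F) : F := (x + c x) ^+ 2 + B * (x * c x).

Definition unital_eq (B x y : F) : Prop := y + c y = unital_form B x.

(** Squaring is additive, so the polar form of [unital_form B] is [B * (x * c x0 + x0 * c x)]. This
    is the trace of the correction term [B * c x0 * (x + x0)]. *)
Lemma unital_eq_translate B x0 y0 x y : c B = B ->
  unital_eq B x0 y0 -> unital_eq B x y ->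
  unital_eq B (x + x0) (y + y0 + B * c x0 * (x + x0)).
Proof.
rewrite /unital_eq /unital_form => cB e0 e1.
rewrite !(rmorphD, rmorphM) /= cK cB.
apply: (lin2 e0 (k := 1)); apply: (lin2 e1 (k := 1)); ring: four0 six0 two0.
Qed.

(** The constant term makes the shear add [e * (x0 * c x0)] at the abscissa [x0], which is right
    there because [e] has trace [B + B']. Expanding [x * c x] around [x0] leaves cross terms that
    are absorbed into the slope, so the condition involves only [x + x0]. *)
Lemma unital_eq_shear B B' e x0 d x y : c B = B -> c B' = B' ->
  e + c e = B + B' -> unital_eq B x y ->
  unital_eq B' x (y + d * x + (d * x0 + e * (x0 * c x0))) <->
  (d + (B + B') * c x0) * (x + x0) + c ((d + (B + B') * c x0) * (x + x0))
    = (B + B') * ((x + x0) * c (x + x0)).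
Proof.
rewrite /unital_eq /unital_form => cB cB' tre e0.
rewrite !(rmorphD, rmorphM) /= !cK cB cB'.
split=> e1; apply: (lin2 e1 (k := 1)); apply: (lin2 e0 (k := 1));
  apply: (lin2 tre (k := x0 * c x0)); ring: four0 six0 two0.
Qed.

Definition anisotropic (B : F) : Prop :=
  forall x, unital_form B x = 0 -> x = 0.

(* For [u2 = t * u1] with [c t = t], collinearity with [(0, r)] makes the left
   side of the equation scale by [t], whereas the form scales by [t ^+ 2]. *)
Lemma secant_independent B r u1 v1 u2 v2 : anisotropic B -> c r = r ->
  unital_eq B u1 v1 -> unital_eq B u2 v2 -> u1 != 0 -> u2 != 0 -> u1 != u2 ->
  u2 * (v1 + r) = u1 * (v2 + r) -> u1 * c u2 != u2 * c u1.
Proof.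
move=> anisoB cr e1 e2 nz1 nz2 neq col; apply/eqP=> dep.
have [t u2E ct] : exists2 t, u2 = t * u1 & c t = t.
  exists (u2 / u1); first by rewrite divfK.
  by rewrite fmorph_div; apply/eqP; rewrite eqr_div ?fmorph_eq0 // mulrC -dep mulrC.
have v2E : v2 = t * (v1 + r) + r.
  have : u1 * (t * (v1 + r)) = u1 * (v2 + r) by rewrite -col u2E; ring.
  move/(mulfI nz1) => ->; apply: eq_add2; ring: four0 six0 two0.
have cu2 : c u2 = t * c u1 by rewrite u2E rmorphM /= ct.
have cv2 : c v2 = t * (c v1 + r) + r.
  by rewrite v2E !(rmorphD, rmorphM) /= ct cr.
have tQ : t * (t + 1) * unital_form B u1 = 0.
  move: e1 e2; rewrite /unital_eq /unital_form cv2 cu2 v2E {1 2}u2E.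
  move=> e1 e2; apply: (lin2 e1 (k := t)); apply: (lin2 e2 (k := 1)).
  ring: four0 six0 two0.
move/eqP: tQ; rewrite !mulf_eq0 addr2_eq0 => /orP[/orP[]|].
- by move=> /eqP t0; case/eqP: nz2; rewrite u2E t0 mul0r.
- by move=> /eqP t1; case/eqP: neq; rewrite u2E t1 mul1r.
- by move/eqP/anisoB/eqP; rewrite (negbTE nz1).
Qed.

(** Adding the collinearities gives [u2 * (v1 + v1') = (u1 + u2) * (r1 + r2)]. Two ordinates over
    the same abscissa differ by an element fixed by [c], hence [u1 / u2] is fixed too, against
    [secant_independent]. *)
Lemma secants_through_fibre B r1 r2 u1 v1 v1' u2 v2 : anisotropic B ->
  c r1 = r1 -> c r2 = r2 -> r1 != r2 ->
  unital_eq B u1 v1 -> unital_eq B u1 v1' -> unital_eq B u2 v2 ->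
  u1 != 0 -> u2 != 0 -> u1 != u2 ->
  u2 * (v1 + r1) = u1 * (v2 + r1) -> u2 * (v1' + r2) = u1 * (v2 + r2) -> False.
Proof.
move=> anisoB cr1 cr2 neqr e1 e1' e2 nz1 nz2 nequ col1 col2.
have := secant_independent anisoB cr1 e1 e2 nz1 nz2 nequ col1.
case/eqP; move: (nz1) (nz2); rewrite -(fmorph_eq0 c) => nzc1.
rewrite -(fmorph_eq0 c) => nzc2.
have tr0 : (v1 + v1') + c (v1 + v1') = 0.
  by rewrite rmorphD addrACA e1 e1'; apply/eqP; rewrite addr2_eq0.
have vE : v1 + v1' = (r1 + r2) * ((u1 + u2) / u2).
  apply: (mulfI nz2); rewrite [RHS]mulrC -mulrA divfK //.
  apply: (lin2 col1 (k := 1)); apply: (lin2 col2 (k := 1)).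
  ring: four0 six0 two0.
have nzr : r1 + r2 != 0 by rewrite addr2_eq0.
move: tr0; rewrite vE rmorphM rmorphD /= cr1 cr2 -mulrDr => /eqP.
rewrite mulf_eq0 (negbTE nzr) /= fmorph_div rmorphD /= addr2_eq0.
rewrite eqr_div // => /eqP dep.
apply: (lin2 dep (k := 1)); ring: four0 six0 two0.
Qed.

(** Cramer's rule for two equations linear in [d] and [c d]. The determinant [D] is fixed by [c], so
    the value found for the second unknown is the conjugate of the first. *)
Lemma trace_solution u1 u2 g1 g2 : c g1 = g1 -> c g2 = g2 ->
  u1 * c u2 != u2 * c u1 ->
  exists d, d * u1 + c (d * u1) = g1 /\ d * u2 + c (d * u2) = g2.
Proof.
move=> cg1 cg2; rewrite -addr2_eq0; set D := _ + _ => nzD.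
have cD : c D = D by rewrite /D rmorphD !rmorphM /= !cK; ring.
exists ((g1 * c u2 + g2 * c u1) / D).
have cd : c ((g1 * c u2 + g2 * c u1) / D) = (g1 * u2 + g2 * u1) / D.
  by rewrite fmorph_div cD rmorphD !rmorphM /= !cK cg1 cg2.
have solve u g : (g1 * c u2 + g2 * c u1) * u + (g1 * u2 + g2 * u1) * c u = g * D ->
    (g1 * c u2 + g2 * c u1) / D * u + c ((g1 * c u2 + g2 * c u1) / D * u) = g.
  move=> e; rewrite rmorphM /= cd -[RHS](mulfK nzD) -e; ring.
by split; apply: solve; apply: eq_add2; rewrite /D; ring: four0 six0 two0.
Qed.

(** Both [d * u1] and [d * u2] are fixed by [c]; eliminating between them leaves the norm [d * c d]
    times a nonzero determinant equal to 0. *)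
Lemma trace_independent u1 u2 d : u1 * c u2 != u2 * c u1 ->
  d * u1 + c (d * u1) = 0 -> d * u2 + c (d * u2) = 0 -> d = 0.
Proof.
move=> dep /eq_add2 e1 /eq_add2 e2.
have : d * c d * (u1 * c u2 + u2 * c u1) = 0.
  move: e1 e2; rewrite !rmorphM /= => e1 e2.
  apply: (lin2 e1 (k := c d * c u2)); apply: (lin2 e2 (k := c d * c u1)).
  ring: four0 six0 two0.
move/eqP; rewrite !mulf_eq0 addr2_eq0 (negbTE dep) fmorph_eq0 orbb orbF.
by move/eqP.
Qed.

Lemma collinear_trace r1 r2 r3 u1 v1 u2 v2 u3 v3 beta d :
  c r1 = r1 -> c r2 = r2 -> c r3 = r3 -> r2 != r3 ->
  u1 != 0 -> u2 != 0 -> u3 != 0 ->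
  u2 * (v1 + r1) = u1 * (v2 + r1) -> u3 * (v1 + r2) = u1 * (v3 + r2) ->
  u3 * (v2 + r3) = u2 * (v3 + r3) ->
  d * u1 + c (d * u1) = beta * (u1 * c u1) ->
  d * u2 + c (d * u2) = beta * (u2 * c u2) ->
  d * u3 + c (d * u3) = beta * (u3 * c u3).
Proof.
move=> cr1 cr2 cr3 neqr nz1 nz2 nz3 col12 col13 col23 e1 e2.
(* Division by [u * c u] makes the condition affine in the inverse of [u]. *)
have normalize u : u != 0 -> d * u + c (d * u) = beta * (u * c u) <->
    d * c u^-1 + c (d * c u^-1) = beta.
  move=> nzu; have nzcu : c u != 0 by rewrite fmorph_eq0.
  rewrite !rmorphM /= !fmorphV cK; split=> [e|<-]; last first.
    by field; rewrite nzu nzcu.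
  transitivity ((d * u + c d * c u) / (u * c u)).
    by field; rewrite nzu nzcu.
  by rewrite e mulfK // mulf_neq0.
(* Divided by the products of their two abscissas, the collinearities add up to [r1 * (1/u1 + 1/u2)
   + r2 * (1/u1 + 1/u3) + r3 * (1/u2 + 1/u3) = 0]; solving for [1/u3] gives [s]. The coefficients
   [1 + s] and [s] are fixed by [c] and sum to 1. *)
pose s := (r1 + r3) / (r2 + r3).
have cs : c s = s by rewrite /s fmorph_div !rmorphD /= cr1 cr2 cr3.
have u3E : u3^-1 = (1 + s) * u1^-1 + s * u2^-1.
  have nzr : r2 + r3 != 0 by rewrite addr2_eq0.
  apply: (mulIf (mulf_neq0 (mulf_neq0 nz1 nz2) (mulf_neq0 nz3 nzr))).
  have -> : u3^-1 * (u1 * u2 * (u3 * (r2 + r3))) = u1 * u2 * (r2 + r3).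
    by field.
  have -> : ((1 + s) * u1^-1 + s * u2^-1) * (u1 * u2 * (u3 * (r2 + r3)))
      = (r2 + r3) * u2 * u3 + (r1 + r3) * (u1 + u2) * u3.
    by rewrite /s; field; rewrite nz1 nz2 nzr.
  apply: (lin2 col12 (k := u3)); apply: (lin2 col13 (k := u2)).
  apply: (lin2 col23 (k := u1)); ring: four0 six0 two0.
clearbody s; apply/(normalize u3 nz3); move/(normalize u1 nz1): e1 => e1.
move/(normalize u2 nz2): e2 => e2.
have cu3 : c u3^-1 = (1 + s) * c u1^-1 + s * c u2^-1.
  by rewrite u3E !(rmorphD, rmorphM) /= rmorph1 cs.
move: e1 e2; rewrite !(rmorphM c d) /= !cK cu3 u3E => e1 e2.
apply: (lin2 e1 (k := 1 + s)); apply: (lin2 e2 (k := s)).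
ring: four0 six0 two0.
Qed.

End CharacteristicTwo.

(** * Points, lines and affine coordinates in the projective plane over a finite field *)

Section ProjectivePlane.

Variable F : finFieldType.
Implicit Types (p l : {set 'rV[F]_3}) (V W : {vspace 'rV[F]_3}).

Definition vec (x y z : F) : 'rV[F]_3 := \row_(i < 3) [:: x; y; z]`_i.

Definition vset (V : {vspace 'rV[F]_3}) : {set 'rV[F]_3} :=
  [set w | w \in V].

Lemma vset_subset V W : (vset V \subset vset W) = (V <= W)%VS.
Proof.
apply/subsetP/subvP => sVW w; first by move=> wV; have := sVW w; rewrite !inE; exact.
by rewrite !inE; apply: sVW.
Qed.

Lemma vset_inj : injective vset.
Proof.
by move=> V W eqVW; apply/eqP; rewrite eqEsubv -!vset_subset eqVW subxx.
Qed.

Lemma pg_subspacesP k (A : {set 'rV[F]_3}) :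
  reflect (exists2 V : {vspace 'rV[F]_3}, \dim V = k & A = vset V)
    (A \in pg_subspaces F k).
Proof.
rewrite inE; apply: (iffP existsP) => [[X /andP[freeX /eqP ->]]|[V dimV ->]].
  by exists <<X>>%VS => //; rewrite (eqnP freeX) size_tuple.
have sz : size (vbasis V) == k by rewrite size_tuple dimV.
exists (Tuple sz); rewrite /= (basis_free (vbasisP V)) /=.
by rewrite (span_basis (vbasisP V)).
Qed.

Lemma pg_point_lineP v : v != 0 -> vset <[v]> \in pg_points F.
Proof.
by move=> nzv; apply/pg_subspacesP; exists <[v]>%VS => //; rewrite dim_vline nzv.
Qed.

Lemma pg_pointP p :
  reflect (exists2 v, v != 0 & p = vset <[v]>) (p \in pg_points F).
Proof.
apply: (iffP idP) => [/pg_subspacesP[V dimV ->]|[v nzv ->]]; last first.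
  exact: pg_point_lineP.
have nzV : V != 0%VS by rewrite -dimv_eq0 dimV.
exists (vpick V); first by rewrite vpick0.
congr vset; apply/eqP; rewrite eq_sym eqEdim -memvE memv_pick dimV.
by rewrite dim_vline vpick0 nzV.
Qed.

Lemma dim_join v w : v != 0 -> w != 0 -> vset <[v]> != vset <[w]> ->
  \dim (<[v]> + <[w]>) = 2%N.
Proof.
move=> nzv nzw neq.
have cap0 : (<[v]> :&: <[w]> = 0)%VS.
  apply/eqP; rewrite -dimv_eq0; apply: contraNT neq => nz.
  apply/eqP; congr vset.
  have d1 : \dim (<[v]> :&: <[w]>) = 1%N.
    apply/eqP; rewrite eqn_leq lt0n nz andbT.
    by rewrite (leq_trans (dimvS (capvSl _ _))) // dim_vline leq_b1.
  transitivity (<[v]> :&: <[w]>)%VS; apply/eqP; last first.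
    by rewrite eqEdim capvSr d1 dim_vline nzw.
  by rewrite eq_sym eqEdim capvSl d1 dim_vline nzv.
by rewrite dimv_disjoint_sum // !dim_vline nzv nzw.
Qed.

Lemma pg_join p p' : p \in pg_points F -> p' \in pg_points F -> p != p' ->
  exists l, [/\ l \in pg_lines F, incident p l & incident p' l].
Proof.
move=> /pg_pointP[v nzv ->] /pg_pointP[w nzw ->] neq.
exists (vset (<[v]> + <[w]>)); split.
- by apply/pg_subspacesP; exists (<[v]> + <[w]>)%VS => //; apply: dim_join.
- by rewrite /incident vset_subset addvSl.
- by rewrite /incident vset_subset addvSr.
Qed.

Lemma pg_line_unique p p' l l' : p \in pg_points F -> p' \in pg_points F ->
  p != p' -> l \in pg_lines F -> l' \in pg_lines F ->
  incident p l -> incident p' l -> incident p l' -> incident p' l' -> l = l'.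
Proof.
move=> /pg_pointP[v nzv ->] /pg_pointP[w nzw ->] neq.
move=> /pg_subspacesP[V dV ->] /pg_subspacesP[W dW ->].
rewrite /incident !vset_subset => vV wV vW wW.
have joinE (X : {vspace 'rV[F]_3}) : \dim X = 2%N -> (<[v]> <= X -> <[w]> <= X ->
    <[v]> + <[w]> = X)%VS.
  move=> dX vX wX; apply/eqP; rewrite eqEdim subv_add vX wX dX /=.
  by rewrite dim_join.
by rewrite -(joinE V) // -(joinE W).
Qed.

Lemma pg_meet l l' : l \in pg_lines F -> l' \in pg_lines F ->
  exists p, [/\ p \in pg_points F, incident p l & incident p l'].
Proof.
move=> /pg_subspacesP[V dV ->] /pg_subspacesP[W dW ->].
have nz : (V :&: W)%VS != 0%VS.
  rewrite -dimv_eq0 -lt0n -(ltn_add2l (\dim (V + W))) dimv_sum_cap dV dW addn0.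
  by rewrite (leq_ltn_trans (dimvS (subvf _))) // dimvf /dim /= mul1n.
have := memv_pick (V :&: W)%VS; rewrite memv_cap => /andP[pV pW].
exists (vset <[vpick (V :&: W)]>); rewrite /incident !vset_subset -!memvE pV pW.
by split=> //; apply: pg_point_lineP; rewrite vpick0.
Qed.

Lemma vecE (w : 'rV[F]_3) : w = vec (w 0 0) (w 0 1) (w 0 2%:R).
Proof.
by apply/rowP=> i; rewrite mxE; case: i => [[|[|[|//]]] lt3] /=; congr (w _ _); apply: val_inj.
Qed.

Lemma homogE x y z : homog x y z = vset <[vec x y z]>.
Proof. by []. Qed.

Lemma homog_point x y z : vec x y z != 0 -> homog x y z \in pg_points F.
Proof. exact: pg_point_lineP. Qed.

Lemma vec_affine_neq0 x y : vec x y 1 != 0.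
Proof.
by apply/eqP=> /rowP/(_ 2%:R); rewrite !mxE /= => /eqP; rewrite oner_eq0.
Qed.

Lemma vec_infty_neq0 : vec 0 1 0 != 0.
Proof.
by apply/eqP=> /rowP/(_ 1); rewrite !mxE /= => /eqP; rewrite oner_eq0.
Qed.

Lemma homog_affine_point x y : homog x y 1 \in pg_points F.
Proof. exact/homog_point/vec_affine_neq0. Qed.

Lemma T_infty_point : T_infty F \in pg_points F.
Proof. exact/homog_point/vec_infty_neq0. Qed.

Lemma homog_affine_neq_infty x y : homog x y 1 != T_infty F.
Proof.
apply/eqP=> /vset_inj eqV.
have : vec x y 1 \in <[(vec 0 1 0)%R]>%VS by rewrite -eqV memv_line.
case/vlineP=> k /rowP/(_ 2%:R); rewrite !mxE /= mulr0 => /eqP.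
by rewrite oner_eq0.
Qed.

Lemma homog_affine_inj (x y x' y' : F) :
  homog x y 1 = homog x' y' 1 -> x = x' /\ y = y'.
Proof.
move=> /vset_inj eqV.
have : vec x y 1 \in <[(vec x' y' 1)%R]>%VS by rewrite -eqV memv_line.
case/vlineP=> k /rowP e; have := e 2%:R; rewrite !mxE /= mulr1 => k1.
by have := e 0; have := e 1; rewrite !mxE /= -k1 !mul1r => -> ->.
Qed.

(** The coefficients form a nonzero vector in the left kernel of the 3 by 2 matrix whose columns are
    a basis of the line. *)
Lemma pg_line_equation l : l \in pg_lines F ->
  exists A B C, [|| A != 0, B != 0 | C != 0] /\
    forall x y z, incident (homog x y z) l -> A * x + B * y + C * z = 0.
Proof.
move=> /pg_subspacesP[V dV ->]; pose M := \matrix_(i < 3, j < 2) (vbasis V)`_j 0 i.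
have : kermx M != 0.
  rewrite -mxrank_eq0 mxrank_ker -lt0n subn_gt0.
  by rewrite (leq_ltn_trans (rank_leq_col M)).
case/rowV0Pn=> u /sub_kermxP uM nzu.
exists (u 0 0), (u 0 1), (u 0 2%:R); split.
  apply: contraNT nzu; rewrite !negb_or !negbK => /and3P[/eqP u0 /eqP u1 /eqP u2].
  rewrite (vecE u) u0 u1 u2; apply/eqP/rowP=> i; rewrite !mxE.
  by case: i => [[|[|[|]]]].
have dot (w : 'rV[F]_3) : w \in V -> \sum_i u 0 i * w 0 i = 0.
  rewrite -(span_basis (vbasisP V)) => /coord_span ->.
  transitivity (\sum_(j < \dim V) coord (vbasis V) j w * \sum_i u 0 i * (vbasis V)`_j 0 i).
    under eq_bigr do rewrite summxE mulr_sumr.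
    rewrite exchange_big; apply: eq_bigr => j _; rewrite mulr_sumr.
    by apply: eq_bigr => i _; rewrite mxE mulrCA.
  rewrite big1 // => j _; have lt2 : (j < 2)%N by apply: leq_trans (ltn_ord j) _; rewrite dV.
  move/rowP/(_ (Ordinal lt2)): uM; rewrite !mxE => e.
  rewrite [X in _ * X](_ : _ = 0) ?mulr0 // -[RHS]e.
  by apply: eq_bigr => i _; rewrite !mxE.
move=> x y z; rewrite /incident homogE vset_subset -memvE => /dot.
by rewrite !big_ord_recl big_ord0 !mxE /= addr0 addrA => <-; congr (_ * _ + _ * _ + _ * _);
  congr (u _ _); apply: val_inj.
Qed.

Lemma pg_collinear l x1 y1 x2 y2 x3 y3 : l \in pg_lines F ->
  incident (homog x1 y1 1) l -> incident (homog x2 y2 1) l ->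
  incident (homog x3 y3 1) l -> (x2 - x1) * (y3 - y1) = (x3 - x1) * (y2 - y1).
Proof.
move=> /pg_line_equation[A [B [C [nz eqn]]]] /eqn e1 /eqn e2 /eqn e3.
have e12 : A * (x2 - x1) + B * (y2 - y1) = 0.
  transitivity ((A * x2 + B * y2 + C * 1) - (A * x1 + B * y1 + C * 1)); first by ring.
  by rewrite e2 e1 subrr.
have e13 : A * (x3 - x1) + B * (y3 - y1) = 0.
  transitivity ((A * x3 + B * y3 + C * 1) - (A * x1 + B * y1 + C * 1)); first by ring.
  by rewrite e3 e1 subrr.
set D := (_ - _) * _; set D' := (_ - _) * _.
have A0 : A * (D - D') = 0.
  transitivity ((A * (x2 - x1) + B * (y2 - y1)) * (y3 - y1)
     - (A * (x3 - x1) + B * (y3 - y1)) * (y2 - y1)); first by rewrite /D /D'; ring.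
  by rewrite e12 e13 !mul0r subrr.
have B0 : B * (D - D') = 0.
  transitivity ((A * (x3 - x1) + B * (y3 - y1)) * (x2 - x1)
     - (A * (x2 - x1) + B * (y2 - y1)) * (x3 - x1)); first by rewrite /D /D'; ring.
  by rewrite e12 e13 !mul0r subrr.
(* If [D - D'] were nonzero, then [A = B = 0] and the line would be the line at infinity, which has
   no affine point. *)
apply: subr0_eq; apply/eqP; move/eqP: A0; move/eqP: B0; rewrite !mulf_eq0.
case/orP=> // /eqP B0; case/orP=> // /eqP A0; move: nz e1.
by rewrite A0 B0 !mul0r !add0r mulr1 eqxx => /= /negP nz /eqP.
Qed.

(** [T_infty] on the line kills the coefficient of [y], and an affine point on it then forces the
    coefficient of [x] to be nonzero. *)
Lemma vertical_line_x l x y x' y' : l \in pg_lines F -> incident (T_infty F) l ->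
  incident (homog x y 1) l -> incident (homog x' y' 1) l -> x = x'.
Proof.
move=> /pg_line_equation[A [B [C [nz eqn]]]] /eqn e0 /eqn e1 /eqn e2.
move: e0; rewrite !mulr0 mulr1 add0r addr0 => B0.
move: nz e1 e2; rewrite B0 !mul0r !addr0 !mulr1 eqxx /= => nz e1 e2.
have nzA : A != 0.
  by apply: contraTneq nz => A0; move: e1; rewrite A0 mul0r add0r eqxx => ->; rewrite eqxx.
by apply: (mulfI nzA); apply: (addIr C); rewrite e1 e2.
Qed.

Lemma vertical_line_incident l x y y' : l \in pg_lines F -> incident (T_infty F) l ->
  incident (homog x y 1) l -> incident (homog x y' 1) l.
Proof.
move=> /pg_subspacesP[V _ ->]; rewrite /incident !homogE !vset_subset -!memvE.
move=> TV pV; rewrite (_ : vec x y' 1 = vec x y 1 + (y' - y) *: vec 0 1 0).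
  by rewrite memvD ?memvZ.
apply/rowP=> i; rewrite !mxE.
by case: i => [[|[|[|//]]] lt3] /=; ring.
Qed.

End ProjectivePlane.

(** * Fano planes and their images under collineations and shears *)

Section FanoPlanes.

Variable F : finFieldType.
Implicit Types (p l : {set 'rV[F]_3}) (U P L : {set {set 'rV[F]_3}}).

(** The join in PG(2,2) carried through the isomorphism, so the joining line is one of the seven. *)
Lemma fano_join U P L p p' : fano_in U P L -> p \in P -> p' \in P -> p != p' ->
  exists l, [/\ l \in L, incident p l & incident p' l].
Proof.
case/and5P=> _ _ _ _ /andP[_ /existsP[f /existsP[g]]].
case/and5P=> _ /eqP <- _ /eqP <- /forall_inP inc.
case/imsetP=> u uP -> /imsetP[v vP ->] neq.
have [|l [lL ul vl]] := pg_join uP vP; first by apply: contraNneq neq => ->.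
exists (g l); rewrite imset_f //.
by rewrite (eqP (forall_inP (inc u uP) l lL)) (eqP (forall_inP (inc v vP) l lL)).
Qed.

Lemma fano_meet U P L l l' : fano_in U P L -> l \in L -> l' \in L ->
  exists p, [/\ p \in P, incident p l & incident p l'].
Proof.
case/and5P=> _ _ _ _ /andP[_ /existsP[f /existsP[g]]].
case/and5P=> _ /eqP <- _ /eqP <- /forall_inP inc.
case/imsetP=> u uL -> /imsetP[v vL ->].
have [p [pP pu pv]] := pg_meet uL vL.
exists (f p); rewrite imset_f //.
by rewrite (eqP (forall_inP (inc p pP) u uL)) (eqP (forall_inP (inc p pP) v vL)).
Qed.

Lemma fano_card_line U P L l : fano_in U P L -> l \in L ->
  #|[set p in P | incident p l]| = 3%N.
Proof. by case/and5P=> _ _ _ _ /andP[/forall_inP c3 _] /c3/eqP. Qed.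

Lemma fano_line U P L l : fano_in U P L -> l \in L -> l \in pg_lines F.
Proof. by case/and5P=> _ _ /subsetP sL _ _ /sL. Qed.

Lemma fano_point_in U P L p : fano_in U P L -> p \in P -> p \in U.
Proof. by case/and5P=> /subsetP sP _ _ _ _ /sP. Qed.

Lemma fano_card U P L : fano_in U P L -> #|P| = 7%N.
Proof. by case/and5P=> _ /eqP. Qed.

Lemma fano_outside U P L (A : {set {set 'rV[F]_3}}) : fano_in U P L ->
  (#|A| < 7)%N -> exists2 p, p \in P & p \notin A.
Proof.
move=> fano; rewrite -(fano_card fano) => ltA; apply/subsetPn.
by apply: contraTN ltA => /subset_leq_card; rewrite -leqNgt.
Qed.

Definition set_map (s : 'End('rV[F]_3)) (A : {set 'rV[F]_3}) : {set 'rV[F]_3} :=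
  [set s w | w in A].

Lemma set_map_vset (s : 'End('rV[F]_3)) V : set_map s (vset V) = vset (s @: V).
Proof.
apply/setP=> w; rewrite inE; apply/imsetP/memv_imgP => [[v]|[v vV ->]].
  by rewrite inE => vV ->; exists v.
by exists v; rewrite // inE.
Qed.

Section Collineation.

Variable s : 'End('rV[F]_3).
Hypothesis s_inj : lker s == 0%VS.

Let s_injective : injective s. Proof. exact/lker0P. Qed.

Lemma set_map_inj : injective (set_map s).
Proof. exact: imset_inj. Qed.

Lemma set_map_incident p l : incident (set_map s p) (set_map s l) = incident p l.
Proof.
rewrite /incident; apply/idP/idP => [|sub]; last exact: imsetS.
move=> /subsetP sub; apply/subsetP=> w wp.
by have /imsetP[v vl /s_injective ->] := sub _ (imset_f s wp).
Qed.

Lemma set_map_subspaces k A :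
  A \in pg_subspaces F k -> set_map s A \in pg_subspaces F k.
Proof.
case/pg_subspacesP=> V dV ->; rewrite set_map_vset; apply/pg_subspacesP.
by exists (s @: V)%VS; rewrite // limg_dim_eq // (eqP s_inj) capv0.
Qed.

Lemma fano_in_map U U' P L : fano_in U P L ->
  (forall p, p \in P -> set_map s p \in U') ->
  fano_in U' (set_map s @: P) (set_map s @: L).
Proof.
move=> fano sU; move: (fano); case/and5P=> _ cP sL cL /andP[_].
case/existsP=> f /existsP[g /and5P[fi /eqP fE gi /eqP gE inc]].
apply/and5P; split; last (apply/andP; split).
- by apply/subsetP=> _ /imsetP[p pP ->]; apply: sU.
- by rewrite card_imset //; apply: set_map_inj.
- apply/subsetP=> _ /imsetP[l lL ->].
  by apply: set_map_subspaces; apply: (subsetP sL).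
- by rewrite card_imset //; apply: set_map_inj.
- apply/forall_inP=> _ /imsetP[l lL ->]; apply/eqP.
  apply: etrans (fano_card_line fano lL).
  rewrite -[RHS](card_imset _ set_map_inj).
  apply: eq_card => q; apply/idP/imsetP.
    rewrite inE => /andP[/imsetP[p pP ->]]; rewrite set_map_incident => pl.
    by exists p; rewrite // inE pP.
  case=> p /setIdP[pP pl] ->.
  by rewrite inE imset_f // set_map_incident.
apply/existsP; exists [ffun p => set_map s (f p)].
apply/existsP; exists [ffun p => set_map s (g p)].
apply/and5P; split.
- apply/dinjectiveP=> x y xP yP; rewrite !ffunE => /set_map_inj.
  by move/dinjectiveP: fi; apply.
- by rewrite -fE -imset_comp; apply/eqP; apply: eq_imset => x; rewrite ffunE.
- apply/dinjectiveP=> x y xP yP; rewrite !ffunE => /set_map_inj.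
  by move/dinjectiveP: gi; apply.
- by rewrite -gE -imset_comp; apply/eqP; apply: eq_imset => x; rewrite ffunE.
apply/forall_inP=> p pP; apply/forall_inP=> l lL; rewrite !ffunE set_map_incident.
exact: (forall_inP (forall_inP inc p pP) l lL).
Qed.

End Collineation.

(** Acting on row vectors from the right, these are the elations with centre [T_infty]: they leave
    [x] and [z] alone and preserve each line through [T_infty]. *)
Definition shear (d e : F) : 'End('rV[F]_3) :=
  linfun (mulmxr (1%:M + d *: delta_mx 0 1 + e *: delta_mx 2%:R 1)).

Lemma shearE d e x y z : shear d e (vec x y z) = vec x (y + d * x + e * z) z.
Proof.
rewrite lfunE /=; apply/rowP=> i; rewrite !mxE !big_ord_recl big_ord0 !mxE.
by case: i => [[|[|[|//]]] lt3] /=; rewrite ?(mulr1n, mulr0n) ; ring.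
Qed.

Lemma shear_homog d e x y z :
  set_map (shear d e) (homog x y z) = homog x (y + d * x + e * z) z.
Proof. by rewrite homogE set_map_vset limg_line shearE. Qed.

Lemma shear_infty d e : set_map (shear d e) (T_infty F) = T_infty F.
Proof. by rewrite shear_homog; congr homog; ring. Qed.

Lemma lker_shear d e : lker (shear d e) == 0%VS.
Proof.
apply/lker0P=> v w; rewrite (vecE v) (vecE w) !shearE => /rowP eqvw.
have := eqvw 2%:R; have := eqvw 0; have := eqvw 1.
rewrite !mxE /= => e1 e0 e2; rewrite e0 e2 in e1 *.
by move: e1; rewrite -!addrA => /addIr ->.
Qed.

Hypothesis two0 : 2%:R = 0 :> F.

Lemma shearK d e : involutive (set_map (shear d e)).
Proof.
move=> A; rewrite /set_map -imset_comp -[RHS]imset_id; apply: eq_imset => w /=.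
rewrite {1}(vecE w) !shearE [RHS]vecE; congr vec.
by apply: (eq_add2 two0); ring: two0.
Qed.

End FanoPlanes.

(** * Special Fano planes in unitals given by their equation *)

Section SpecialFanoPlanes.

Variables (F : finFieldType) (c : {rmorphism F -> F}).
Hypotheses (two0 : 2%:R = 0 :> F) (cK : involutive c).
Implicit Types (p l : {set 'rV[F]_3}) (U P L : {set {set 'rV[F]_3}}).

(** Describes the unital through [B] alone, which keeps [b] out of the counting argument. *)
Definition unital_points (B : F) U : Prop := forall p, p \in U <->
  p = T_infty F \/ exists x y, p = homog x y 1 /\ unital_eq c B x y.

Lemma unital_affine B U x y : unital_points B U ->
  homog x y 1 \in U <-> unital_eq c B x y.
Proof.
move=> UB; rewrite UB; split=> [[/eqP|[x' [y' [/homog_affine_inj[-> ->]]]]]|e] //.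
  by rewrite (negbTE (homog_affine_neq_infty x y)).
by right; exists x, y.
Qed.

Lemma unital_pg_point B U p : unital_points B U -> p \in U -> p \in pg_points F.
Proof.
move=> UB /UB[->|[x [y [-> _]]]]; first exact: T_infty_point.
exact: homog_affine_point.
Qed.

Section OneUnital.

Variables (B : F) (U P L : {set {set 'rV[F]_3}}).
Hypotheses (cB : c B = B) (anisoB : anisotropic c B) (UB : unital_points B U).
Hypothesis fano : fano_in U P L.

Lemma fano_line_eq p p' l l' : p \in P -> p' \in P -> p != p' ->
  l \in L -> l' \in L -> incident p l -> incident p' l ->
  incident p l' -> incident p' l' -> l = l'.
Proof.
move=> pP pP' neq lL lL'; apply: pg_line_unique => //;
  by [apply: unital_pg_point UB _; apply: fano_point_in fano _
     |apply: fano_line fano _].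
Qed.

Lemma fano_affine p : p \in P -> p != T_infty F ->
  exists x y, p = homog x y 1 /\ unital_eq c B x y.
Proof. by move=> /(fano_point_in fano)/UB[-> /eqP|]. Qed.

(* The translation moving the base point [(x0, y0)] of the unital to [(0, 0)]. *)
Definition shifted x0 y0 x y := y + y0 + B * c x0 * (x + x0).

(** [shifted] is affine in the coordinates, so it preserves collinearity, and it sends [p] to
    [(0, r)] with [r] the difference of two ordinates over [x0]. Both points satisfy the unital
    equation there, hence [c r = r]. *)
Lemma secant_slope l m p x0 y0 : l \in L -> m \in L -> incident (T_infty F) l ->
  homog x0 y0 1 \in P -> incident (homog x0 y0 1) l ->
  p \in P -> p != T_infty F -> incident p l -> incident p m ->
  exists r, [/\ c r = r, p = homog x0 (r + y0) 1 & forall x1 y1 x2 y2,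
    incident (homog x1 y1 1) m -> incident (homog x2 y2 1) m ->
    (x2 + x0) * (shifted x0 y0 x1 y1 + r)
      = (x1 + x0) * (shifted x0 y0 x2 y2 + r)].
Proof.
move=> lL mL Tl p0P p0l pP pnT pl pm.
have lpg := fano_line fano lL; have mpg := fano_line fano mL.
have [x [y [pE e]]] := fano_affine pP pnT; rewrite pE in pl pm.
have xE := vertical_line_x lpg Tl pl p0l; rewrite xE in pE pl pm e.
have e0 : unital_eq c B x0 y0.
  by apply/(unital_affine _ _ UB); apply: fano_point_in fano _.
exists (y + y0); split.
- move: e e0; rewrite /unital_eq => e e0; rewrite rmorphD.
  by apply: (lin2 two0 e (k := 1)); apply: (lin2 two0 e0 (k := 1)); ring: two0.
- by rewrite pE; congr homog; apply: (eq_add2 two0); ring: (four0 two0) two0.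
move=> x1 y1 x2 y2 i1 i2; have := pg_collinear mpg pm i1 i2.
have oppE (z : F) : - z = z.
  by apply: (eq_add2 two0); rewrite addNr.
rewrite !oppE => col; rewrite /shifted.
apply: (lin2 two0 col (k := 1)); ring: (four0 two0) two0.
Qed.

Lemma off_vertical l x0 y0 x y : l \in L -> incident (T_infty F) l ->
  incident (homog x0 y0 1) l -> ~~ incident (homog x y 1) l -> x + x0 != 0.
Proof.
move=> lL Tl p0l; apply: contraNneq => /(eq_add2 two0) ->.
exact: vertical_line_incident (fano_line fano lL) Tl p0l.
Qed.

Lemma secant_x_neq x0 y0 r x1 y1 x2 y2 : x1 + x0 != 0 ->
  homog x1 y1 1 != homog x2 y2 1 ->
  (x2 + x0) * (shifted x0 y0 x1 y1 + r) = (x1 + x0) * (shifted x0 y0 x2 y2 + r) ->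
  x1 + x0 != x2 + x0.
Proof.
move=> nz neq col; apply: contraNneq neq => /addIr eqx; rewrite -eqx in col *.
move/(mulfI nz)/addIr: col; rewrite /shifted => /addIr/addIr ->.
by rewrite eqxx.
Qed.

Lemma fano_point_unital x y : homog x y 1 \in P -> unital_eq c B x y.
Proof. by move/(fano_point_in fano)/(unital_affine _ _ UB). Qed.

(** Suppose [T_infty] is a Fano point, and take two Fano lines [l0], [l1] through it. The other
    points [a], [d] of [l1] share an abscissa, and joining them to a point [b] off both lines cuts
    [l0] in distinct affine points. This is the configuration excluded by
    [secants_through_fibre]. *)
Lemma infty_notin_fano : T_infty F \notin P.
Proof.
apply/negP=> TP.
have [|t tP] := fano_outside (A := [set T_infty F]) fano; first by rewrite cards1.
rewrite inE eq_sym => neqt.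
have [l0 [l0L Tl0 _]] := fano_join fano TP tP neqt.
have [|a aP] := fano_outside (A := [set p in P | incident p l0]) fano.
  by rewrite (fano_card_line fano l0L).
rewrite inE aP /= => al0.
have neqTa : T_infty F != a by apply: contraNneq al0 => <-.
have [l1 [l1L Tl1 al1]] := fano_join fano TP aP neqTa.
have [d] : exists2 d, d \in [set p in P | incident p l1] & d \notin [set T_infty F; a].
  apply/subsetPn; apply/negP=> /subset_leq_card.
  by rewrite (fano_card_line fano l1L) cards2 neqTa.
rewrite !inE negb_or => /andP[dP dl1] /andP[neqdT neqda].
(* The two lines cover at most six of the seven points. *)
have [|b bP] := fano_outside fano
    (A := [set p in P | incident p l0] :|: [set p in P | incident p l1]).
  rewrite (leq_ltn_trans (leq_card_setU _ _)) //.
  by rewrite !(fano_card_line fano).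
rewrite !inE bP /= negb_or => /andP[bl0 bl1].
have dl0 : ~~ incident d l0.
  apply: contra al0 => dl0.
  by rewrite (fano_line_eq dP TP neqdT l0L l1L).
have neqbT : b != T_infty F by apply: contraNneq bl0 => ->.
have neqba : b != a by apply: contraNneq bl1 => ->.
have neqbd : b != d by apply: contraNneq bl1 => ->.
have [m1 [m1L bm1 am1]] := fano_join fano bP aP neqba.
have [m2 [m2L bm2 dm2]] := fano_join fano bP dP neqbd.
have [p1 [p1P p1m1 p1l0]] := fano_meet fano m1L l0L.
have [p2 [p2P p2m2 p2l0]] := fano_meet fano m2L l0L.
have neqp1T : p1 != T_infty F.
  apply: contraNneq bl1 => p1T; rewrite p1T in p1m1.
  by rewrite (fano_line_eq TP aP neqTa l1L m1L).
have neqp2T : p2 != T_infty F.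
  apply: contraNneq bl1 => p2T; rewrite p2T in p2m2.
  by rewrite (fano_line_eq dP TP neqdT l1L m2L).
have neqp12 : p1 != p2.
  apply: contraNneq bl1 => p12; rewrite -p12 in p2m2.
  have neqbp1 : b != p1 by apply: contraNneq bl0 => ->.
  have m12 := fano_line_eq bP p1P neqbp1 m1L m2L bm1 p1m1 bm2 p2m2.
  rewrite -m12 in dm2.
  by rewrite (fano_line_eq dP aP neqda l1L m1L).
have [x0 [y0 [p1E _]]] := fano_affine p1P neqp1T.
have neqaT : a != T_infty F by rewrite eq_sym.
have [xa [ya [aE ea]]] := fano_affine aP neqaT.
have [xd [yd [dE ed]]] := fano_affine dP neqdT.
have [xb [yb [bE eb]]] := fano_affine bP neqbT.
have e0 : unital_eq c B x0 y0 by apply: fano_point_unital; rewrite -p1E.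
have xad : xd = xa.
  by apply: (vertical_line_x (fano_line fano l1L) Tl1 (y := yd) (y' := ya));
    rewrite -?dE -?aE.
subst a d b p1.
(* [p1] serves both as the base point of the shift and as the trace of [m1] on [l0]. *)
have [r1 [cr1 p1E col1]] := secant_slope l0L m1L Tl0 p1P p1l0 p1P neqp1T p1l0 p1m1.
have [r2 [cr2 p2E col2]] := secant_slope l0L m2L Tl0 p1P p1l0 p2P neqp2T p2l0 p2m2.
have nza := off_vertical l0L Tl0 p1l0 al0.
have nzb := off_vertical l0L Tl0 p1l0 bl0.
have neqr : r1 != r2.
  by apply: contraNneq neqp12 => r12; rewrite p2E -r12 -p1E.
have c1 := col1 _ _ _ _ am1 bm1; have c2 := col2 _ _ _ _ dm2 bm2.
have := unital_eq_translate two0 cK cB e0.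
move=> tr; have ta := tr _ _ ea; have td := tr _ _ ed; have tb := tr _ _ eb.
rewrite xad in td c2.
apply: (secants_through_fibre two0 anisoB cr1 cr2 neqr ta td tb nza nzb _ c1 c2).
by apply: secant_x_neq nza _ c1; rewrite eq_sym.
Qed.

Lemma fano_affineE p : p \in P ->
  exists x y, p = homog x y 1 /\ unital_eq c B x y.
Proof.
move=> pP; apply: fano_affine => //; apply: contraNneq infty_notin_fano => <- //.
Qed.

(** The Fano point common to both lines differs from [T_infty], so the lines share two points. *)
Lemma special_line_unique l l' : l \in L -> l' \in L ->
  incident (T_infty F) l -> incident (T_infty F) l' -> l = l'.
Proof.
move=> lL lL' Tl Tl'; have [p [pP pl pl']] := fano_meet fano lL lL'.
apply: (pg_line_unique (p := p) (p' := T_infty F)) => //.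
- by apply: unital_pg_point UB _; apply: fano_point_in fano _.
- exact: T_infty_point.
- by apply: contraNneq infty_notin_fano => <-.
- exact: fano_line fano _.
- exact: fano_line fano _.
Qed.

(** Join two Fano points off [l] and take as base the Fano point where the join meets [l];
    [secant_independent] then applies. *)
Lemma special_line_secant l : l \in L -> incident (T_infty F) l ->
  exists x0 y0 x1 y1 x2 y2, [/\ homog x0 y0 1 \in P, incident (homog x0 y0 1) l,
    [/\ homog x1 y1 1 \in P, ~~ incident (homog x1 y1 1) l,
    homog x2 y2 1 \in P & ~~ incident (homog x2 y2 1) l],
    homog x1 y1 1 != homog x2 y2 1 &
    (x1 + x0) * c (x2 + x0) != (x2 + x0) * c (x1 + x0)].
Proof.
move=> lL Tl; set A := [set p in P | incident p l].
have cA : #|A| = 3%N := fano_card_line fano lL.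
have [|a aP] := fano_outside (A := A) fano; first by rewrite cA.
rewrite inE aP /= => al.
have [|b bP] := fano_outside (A := a |: A) fano.
  by rewrite cardsU1 cA; case: (_ \notin _).
rewrite !inE bP negb_or eq_sym => /= /andP[neqab bl].
have [m [mL am bm]] := fano_join fano aP bP neqab.
have [p [pP pm pl]] := fano_meet fano mL lL.
have [x0 [y0 [pE e0]]] := fano_affineE pP.
have [x1 [y1 [aE e1]]] := fano_affineE aP.
have [x2 [y2 [bE e2]]] := fano_affineE bP.
subst p a b.
have [r [cr _ col]] :=
  secant_slope lL mL Tl pP pl pP (homog_affine_neq_infty _ _) pl pm.
have c12 := col _ _ _ _ am bm.
have nz1 := off_vertical lL Tl pl al.
have nz2 := off_vertical lL Tl pl bl.
exists x0, y0, x1, y1, x2, y2; split=> //.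
have tr := unital_eq_translate two0 cK cB e0.
apply: (secant_independent two0 anisoB cr (tr _ _ e1) (tr _ _ e2)) => //.
exact: secant_x_neq nz1 neqab c12.
Qed.

(* Otherwise the line joining [p1] and [p2] would carry the four points [p1],
   [p2], [p3] and [p]. *)
Lemma secants_distinct l m1 m2 p1 p2 p3 p : l \in L -> m1 \in L -> m2 \in L ->
  p1 \in P -> p2 \in P -> p3 \in P -> p \in P -> incident p l ->
  ~~ incident p1 l -> ~~ incident p2 l -> ~~ incident p3 l ->
  p1 != p2 -> p1 != p3 -> p2 != p3 ->
  incident p1 m1 -> incident p3 m1 -> incident p2 m2 -> incident p3 m2 ->
  incident p m1 -> ~~ incident p m2.
Proof.
move=> lL m1L m2L p1P p2P p3P pP pl p1l p2l p3l n12 n13 n23 i1 i3 j2 j3 im1.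
apply/negP=> im2.
have off q : ~~ incident q l -> q != p by move=> ql; apply: contraNneq ql => ->.
have m12 := fano_line_eq p3P pP (off _ p3l) m1L m2L i3 im1 j3 im2.
have : (size [:: p1; p2; p3; p] <= #|[set q in P | incident q m1]|)%N.
  have /card_uniqP <- : uniq [:: p1; p2; p3; p].
    by rewrite /= !inE !negb_or n12 n13 n23 !off.
  apply/subset_leq_card/subsetP=> q; rewrite !inE.
  by case/or4P=> /eqP ->; rewrite ?p1P ?p2P ?p3P ?pP //= ?i1 ?i3 ?im1 // m12.
by rewrite (fano_card_line fano m1L).
Qed.

(** Normalised as in [unital_eq_shear]: at the abscissa [x0] the effect does not depend on [d]. *)
Definition unital_shear (e x0 d : F) : 'End('rV[F]_3) :=
  shear d (d * x0 + e * (x0 * c x0)).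

(** The first conjunct ties [t.1] to the abscissa of the special line; this is what allows [t] to be
    unique. *)
Definition shear_into (e : F) U P L (t : F * F) : bool :=
  [exists l in L, incident (T_infty F) l &&
     [exists y0, incident (homog t.1 y0 1) l]]
  && [forall p in P, set_map (unital_shear e t.1 t.2) p \in U].

Section SecondUnital.

Variables (B' e : F) (U' : {set {set 'rV[F]_3}}).
Hypotheses (cB' : c B' = B') (UB' : unital_points B' U').
Hypothesis tre : e + c e = B + B'.

Lemma unital_shearP x0 d x y : homog x y 1 \in P ->
  set_map (unital_shear e x0 d) (homog x y 1) \in U' <->
  (d + (B + B') * c x0) * (x + x0) + c ((d + (B + B') * c x0) * (x + x0))
    = (B + B') * ((x + x0) * c (x + x0)).
Proof.
move=> /fano_point_unital e0; rewrite shear_homog mulr1 (unital_affine _ _ UB').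
exact: unital_eq_shear.
Qed.

Lemma shear_into_exists : BM_special L -> exists t, shear_into e U' P L t.
Proof.
case/exists_inP=> l lL Tl.
have [x0 [y0 [x1 [y1 [x2 [y2 [p0P p0l [p1P p1l p2P p2l] neq12 ind]]]]]]] :=
  special_line_secant lL Tl.
pose beta := B + B'; have cbeta : c beta = beta by rewrite rmorphD cB cB'.
have norm_fixed u : c (beta * (u * c u)) = beta * (u * c u).
  by rewrite !rmorphM /= cbeta cK; congr (_ * _); rewrite mulrC.
have [d [e1 e2]] := trace_solution two0 cK (norm_fixed (x1 + x0)) (norm_fixed (x2 + x0)) ind.
(* The criterion [unital_shearP] adds [beta * c x0] to the slope; adding it beforehand cancels
   this. *)
have dE : d = d + beta * c x0 + beta * c x0.
  by apply: (eq_add2 two0); ring: two0.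
exists (x0, d + beta * c x0); apply/andP; split.
  by apply/exists_inP; exists l; rewrite //= Tl; apply/existsP; exists y0.
apply/forall_inP=> p pP /=; have [x3 [y3 [pE _]]] := fano_affineE pP; subst p.
apply/unital_shearP => //; rewrite -/beta -dE.
(* On the special line both sides vanish; at the two chosen points the condition holds by the choice
   of [d]; any other point is reached through [collinear_trace]. *)
have [p3l|p3l] := boolP (incident (homog x3 y3 1) l).
  have -> : x3 + x0 = 0.
    apply: (add2_eq two0).
    exact: vertical_line_x (fano_line fano lL) Tl p3l p0l.
  by rewrite !(mulr0, mul0r) rmorph0 addr0.
have [/homog_affine_inj[<- _] //|neq13] := eqVneq (homog x1 y1 1) (homog x3 y3 1).
have [/homog_affine_inj[<- _] //|neq23] := eqVneq (homog x2 y2 1) (homog x3 y3 1).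
have [m1 [m1L i1 i2]] := fano_join fano p1P p2P neq12.
have [m2 [m2L j1 j3]] := fano_join fano p1P pP neq13.
have [m3 [m3L k2 k3]] := fano_join fano p2P pP neq23.
have slope m : m \in L -> exists q r, [/\ q \in P, incident q m & incident q l] /\
    [/\ c r = r, q = homog x0 (r + y0) 1 &
    forall x1 y1 x2 y2, incident (homog x1 y1 1) m -> incident (homog x2 y2 1) m ->
    (x2 + x0) * (shifted x0 y0 x1 y1 + r)
      = (x1 + x0) * (shifted x0 y0 x2 y2 + r)].
  move=> mL; have [q [qP qm ql]] := fano_meet fano mL lL.
  have nqT : q != T_infty F by apply: contraNneq infty_notin_fano => <-.
  have [r [cr qE col]] := secant_slope lL mL Tl p0P p0l qP nqT ql qm.
  by exists q, r; split.
have [q1 [r1 [_ [cr1 _ col1]]]] := slope _ m1L.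
have [q2 [r2 [[q2P q2m q2l] [cr2 q2E col2]]]] := slope _ m2L.
have [q3 [r3 [[q3P q3m q3l] [cr3 q3E col3]]]] := slope _ m3L.
(* Equal values would make two of the joining lines meet the special line in the same Fano point. *)
have neqr : r2 != r3.
  apply/eqP=> r23; have q23 : q2 = q3 by rewrite q2E q3E r23.
  have := secants_distinct lL m2L m3L p1P p2P pP q2P q2l p1l p2l p3l neq12 neq13
    neq23 j1 j3 k2 k3 q2m.
  by rewrite q23 q3m.
exact: (collinear_trace two0 cK cr1 cr2 cr3 neqr (off_vertical lL Tl p0l p1l)
  (off_vertical lL Tl p0l p2l) (off_vertical lL Tl p0l p3l) (col1 _ _ _ _ i1 i2)
  (col2 _ _ _ _ j1 j3) (col3 _ _ _ _ k2 k3)).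
Qed.

(** The special line determines the abscissa. For two slopes, the conditions add up to [d + d']
    having trace 0 against two independent elements, so [d = d']. *)
Lemma shear_into_unique t t' : shear_into e U' P L t -> shear_into e U' P L t' ->
  t = t'.
Proof.
case: t t' => [x d] [x' d'] /andP[/exists_inP[l lL /andP[Tl /existsP[y pl]]] /forall_inP sh].
move=> /andP[/exists_inP[l' lL' /andP[Tl' /existsP[y' pl']]] /forall_inP sh'].
rewrite /= in pl pl' sh sh'.
rewrite -(special_line_unique lL lL' Tl Tl') in pl'.
have xx' : x = x' := vertical_line_x (fano_line fano lL) Tl pl pl'.
subst x'; congr pair.
have [x0 [y0 [x1 [y1 [x2 [y2 [p0P p0l [p1P p1l p2P p2l] neq12 ind]]]]]]] :=
  special_line_secant lL Tl.
have x0E : x0 = x := vertical_line_x (fano_line fano lL) Tl p0l pl.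
rewrite x0E in ind.
have diff x3 y3 : homog x3 y3 1 \in P ->
    (d + d') * (x3 + x) + c ((d + d') * (x3 + x)) = 0.
  move=> p3P; have /(unital_shearP x d p3P) e1 := sh _ p3P.
  have /(unital_shearP x d' p3P) e2 := sh' _ p3P.
  have -> : d + d' = (d + (B + B') * c x) + (d' + (B + B') * c x).
    by apply: (eq_add2 two0); ring: (four0 two0) (six0 two0) two0.
  rewrite mulrDl rmorphD addrACA e1 e2; exact: add2_eq.
apply: (eq_add2 two0); exact: (trace_independent two0 ind (diff _ _ p1P) (diff _ _ p2P)).
Qed.

End SecondUnital.

End OneUnital.

(** * Matching the special Fano planes of two unitals *)

Definition shear_fano (e : F) (t : F * F) (PL : {set {set 'rV[F]_3}} * {set {set 'rV[F]_3}}) :=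
  (set_map (unital_shear e t.1 t.2) @: PL.1, set_map (unital_shear e t.1 t.2) @: PL.2).

Lemma shear_fanoK e t : involutive (shear_fano e t).
Proof.
move=> [P L]; rewrite /shear_fano /= -!imset_comp.
by congr pair; rewrite -[RHS]imset_id; apply: eq_imset => p /=; rewrite shearK.
Qed.

(** The shear is an involution fixing [T_infty] and keeping abscissas, so the same [t] leads back
    into [U]. *)
Lemma shear_fano_into e t U U' P L : fano_in U P L -> shear_into e U' P L t ->
  fano_in U' (shear_fano e t (P, L)).1 (shear_fano e t (P, L)).2
  /\ shear_into e U (shear_fano e t (P, L)).1 (shear_fano e t (P, L)).2 t.
Proof.
move=> fano /andP[/exists_inP[l lL /andP[Tl /existsP[y pl]]] /forall_inP sh].
split; first by apply: fano_in_map fano sh; apply: lker_shear.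
apply/andP; split; last first.
  apply/forall_inP=> _ /imsetP[p pP ->]; rewrite shearK //.
  exact: fano_point_in fano pP.
apply/exists_inP; exists (set_map (unital_shear e t.1 t.2) l); first exact: imset_f.
rewrite -{1}(shear_infty t.2 (t.2 * t.1 + e * (t.1 * c t.1))).
rewrite set_map_incident ?lker_shear // Tl; apply/existsP.
eexists; rewrite -(set_map_incident (lker_shear t.2 (t.2 * t.1 + e * (t.1 * c t.1)))) in pl.
by rewrite shear_homog in pl; apply: pl.
Qed.

Lemma shear_into_special e U P L t : shear_into e U P L t -> BM_special L.
Proof.
case/andP=> /exists_inP[l lL /andP[Tl _]] _.
by apply/exists_inP; exists l.
Qed.

Lemma leq_card_special B B' e U U' : c B = B -> c B' = B' ->
  anisotropic c B -> anisotropic c B' ->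
  unital_points B U -> unital_points B' U' -> e + c e = B + B' ->
  (#|BM_special_fanos U| <= #|BM_special_fanos U'|)%N.
Proof.
move=> cB cB' anisoB anisoB' UB UB' tre.
pose f PL := if [pick t | shear_into e U' PL.1 PL.2 t] is Some t
  then shear_fano e t PL else PL.
have fP PL : PL \in BM_special_fanos U -> exists t,
    [/\ shear_fano e t (f PL) = PL, f PL \in BM_special_fanos U'
       & shear_into e U (f PL).1 (f PL).2 t].
  case: PL => P L; rewrite inE => /andP[/= fano spec].
  have [t0 t0P] := shear_into_exists cB anisoB UB fano cB' UB' tre spec.
  rewrite /f; case: pickP => [t tP|/(_ t0)]; last by rewrite t0P.
  have [fano' into'] := shear_fano_into fano tP; exists t.
  rewrite shear_fanoK inE fano' (shear_into_special into'); split=> //.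
have tre' : e + c e = B' + B by rewrite tre addrC.
(* Injectivity: both shears lead from the common image back into [U], so uniqueness with the unitals
   exchanged identifies them, and applying the shear recovers the plane. *)
rewrite -(card_in_imset (f := f)); last first.
  move=> PL1 PL2 /fP[t1 [K1 S1 into1]] /fP[t2 [K2 _ into2]] eqf.
  rewrite -eqf in K2 into2; rewrite -K1 -K2; congr shear_fano.
  move: S1; rewrite inE => /andP[fano _].
  exact: (shear_into_unique cB' anisoB' UB' fano cB UB tre' into1 into2).
by apply/subset_leq_card/subsetP=> _ /imsetP[PL /fP[t [_ S _]] ->].
Qed.

End SpecialFanoPlanes.

(** * The Frobenius involution, the absolute trace and the concrete unitals *)

Lemma expr2n_add (F : fieldType) (n : nat) (x y : F) : 2%:R = 0 :> F ->
  (x + y) ^+ (2 ^ n) = x ^+ (2 ^ n) + y ^+ (2 ^ n).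
Proof.
move=> two0; elim: n => [|n IHn]; first by rewrite !expr1.
rewrite expnSr !exprM IHn; apply: (eq_add2 two0); ring: two0.
Qed.

Lemma frobenius_involution (F : finFieldType) (m q : nat) : q = (2 ^ m)%N ->
  2%:R = 0 :> F -> #|F| = (q ^ 2)%N ->
  exists c : {rmorphism F -> F}, (forall x, c x = x ^+ q) /\ involutive c.
Proof.
move=> qE two0 cardF; pose f (x : F) := x ^+ q.
have fB : zmod_morphism f.
  move=> x y; have oppE (z : F) : - z = z by apply: (eq_add2 two0); rewrite addNr.
  by rewrite /f !oppE qE expr2n_add.
have fM : monoid_morphism f by split=> [|x y]; rewrite /f ?expr1n ?exprMn.
pose fBi := GRing.isZmodMorphism.Build F F f fB.
pose fMi := GRing.isMonoidMorphism.Build F F f fM.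
exists (HB.pack f fBi fMi : {rmorphism F -> F}); split=> // x.
by rewrite /= /f -exprM mulnn -cardF expf_card.
Qed.

(** The summands are [s ^+ (2 ^ i.+1) + s ^+ (2 ^ i)], so the sum telescopes. *)
Lemma abs_trace_artin_schreier (F : finFieldType) (m : nat) (s : F) :
  2%:R = 0 :> F -> abs_trace m (s ^+ 2 + s) = s ^+ (2 ^ m) + s.
Proof.
move=> two0; rewrite /abs_trace; elim: m => [|m IHm].
  by rewrite big_ord0 expn0 expr1 (add2_eq two0).
rewrite big_ord_recr /= IHm expr2n_add // -exprM -expnS.
by apply: (eq_add2 two0); ring: two0.
Qed.

Section Unital.

Variables (F : finFieldType) (m q : nat) (c : {rmorphism F -> F}).
Hypotheses (two0 : 2%:R = 0 :> F) (qE : q = (2 ^ m)%N).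
Hypotheses (cE : forall x, c x = x ^+ q) (cK : involutive c).

Lemma BM_unital_points b : unital_points c (b ^+ q + b) (BM_unital q 1 b).
Proof.
move=> p; rewrite /BM_unital in_setU in_set1.
have -> : b ^+ q + b = c b + b by rewrite cE.
have normE x : x ^+ q.+1 = x * c x by rewrite exprS cE.
split=> [/orP[/imset2P[x r _]|/eqP ->]|[->|[x [y [-> e]]]]].
- rewrite inE -cE => /eqP cr ->; right; exists x, (1 * x ^+ 2 + b * x ^+ q.+1 + r).
  split=> //; rewrite /unital_eq /unital_form normE mul1r !(rmorphD, rmorphM, rmorphXn) /=.
  by rewrite cK cr; apply: (eq_add2 two0); ring: (four0 two0) two0.
- by left.
- by rewrite eqxx orbT.
apply/orP; left; apply/imset2P.
(* This is the parametrisation solved for [r]; the unital equation says exactly that it is fixed by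
   [c]. *)
exists x (y + x ^+ 2 + b * (x * c x)); rewrite ?inE //.
  rewrite -cE; apply/eqP.
  rewrite !(rmorphD, rmorphM, rmorphXn) /= cK; move: e; rewrite /unital_eq /unital_form => e.
  by apply: (lin2 two0 e (k := 1)); ring: (four0 two0) two0.
by rewrite normE mul1r; congr homog; apply: (eq_add2 two0); ring: (four0 two0) two0.
Qed.

(* A nonzero isotropic [x] rescales to [t] with [t + c t = 1] and
   [t * c t = 1 / B], so [1 / B = t ^+ 2 + t] has trace [t ^+ q + t = 1]. *)
Lemma BM_anisotropic b : BM_params m 1 b -> anisotropic c (b ^+ q + b).
Proof.
case; rewrite -qE expr1n => /eqP nb trB x; rewrite /unital_form.
set B := b ^+ q + b in trB *.
have nzB : B != 0 by rewrite (addr2_eq0 two0).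
move/(eq_add2 two0)=> e; apply/eqP; apply: contraT => nzx.
have nzcx : c x != 0 by rewrite fmorph_eq0.
have nzT : x + c x != 0.
  by rewrite -sqrf_eq0 e !mulf_neq0.
have cT : c (x + c x) = x + c x by rewrite rmorphD /= cK addrC.
pose t := x / (x + c x).
have ct : c t = c x / (x + c x) by rewrite /t fmorph_div cT.
have t1 : t + c t = 1 by rewrite ct /t -mulrDl divff.
have tN : t ^+ 2 + t = B^-1.
  have -> : t ^+ 2 + t = t * c t.
    have -> : c t = 1 + t.
      by rewrite -t1; apply: (eq_add2 two0); ring: (four0 two0) two0.
    by ring.
  rewrite ct /t mulrACA -invfM -expr2 e; field.
  by rewrite nzB nzx nzcx.
(* The hypothesis concerns the inverse of [B ^+ 2], hence the square of [t ^+ 2 + t]; its trace is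
   [(t + c t) ^+ 2 = 1]. *)
have : abs_trace m ((t ^+ 2) ^+ 2 + t ^+ 2) = 0.
  rewrite -[RHS]trB; congr abs_trace; rewrite div1r -exprVn -tN.
  by apply: (eq_add2 two0); ring: two0.
rewrite abs_trace_artin_schreier // -qE -cE rmorphXn /=.
have -> : c t ^+ 2 + t ^+ 2 = (t + c t) ^+ 2.
  by apply: (eq_add2 two0); ring: (four0 two0) two0.
by rewrite t1 expr1n => /eqP; rewrite oner_eq0.
Qed.

End Unital.

Theorem theorem2 (m q : nat) (F : finFieldType) (b b' : F)
    (hq : q = (2 ^ m)%N) (q_gt2 : (2 < q)%N) (hF : #|F| = (q ^ 2)%N)
    (hb : BM_params m 1 b) (hb' : BM_params m 1 b') :
  #|BM_special_fanos (BM_unital q 1 b)|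
  = #|BM_special_fanos (BM_unital q 1 b')|.
Proof.
have two0 : 2%:R = 0 :> F.
  have cardF : #|F| = (2 ^ (m * 2))%N by rewrite hF hq expnM.
  by have /pcharf0 := card_finPcharP cardF isT.
have [c [cE cK]] := frobenius_involution hq two0 hF.
have fixed x : c (x ^+ q + x) = x ^+ q + x by rewrite -cE rmorphD /= cK addrC.
(* [b + b'] is the scalar [e] of the shears, and it serves in both directions. *)
have tre : b + b' + c (b + b') = (b ^+ q + b) + (b' ^+ q + b').
  by rewrite rmorphD !cE; ring.
have aniso := BM_anisotropic two0 hq cE cK hb.
have aniso' := BM_anisotropic two0 hq cE cK hb'.
have pts := BM_unital_points two0 cE cK b.
have pts' := BM_unital_points two0 cE cK b'.
apply/eqP; rewrite eqn_leq; apply/andP; split.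
  exact: (leq_card_special two0 cK (fixed b) (fixed b') aniso aniso' pts pts' tre).
have tre' := etrans tre (addrC _ _).
exact: (leq_card_special two0 cK (fixed b') (fixed b) aniso' aniso pts' pts tre').
Qed.
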